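(* For all $x\in[0,\pi_{3/2,2}/4)$, $$\sin_{3/2,2}(2x)=(\Phi\circ\Psi\circ\Phi^{-1})(\sin_{3/2,2}x),$$ where $$\Phi(x)=\sqrt{1-\left(\frac{2-2x^2+2\sqrt{1-x^3}}{2+x^2+2\sqrt{1-x^3}}\right)^3},$$ $$\Psi(x)=\frac{4x\sqrt{1-x^3}\,(3+\sqrt{1-x^3})^3}{(1+\sqrt{1-x^3})(8+x^3)^2},$$ $$\Phi^{-1}(x)=\frac{6x-2\bigl(1-(1-x^2)^{1/3}\bigr)^2}{\bigl(2+(1-x^2)^{1/3}\bigr)^2}.$$
   Context: For $p,q>1$, let $\pi_{p,q}=2\int_0^1\frac{dt}{(1-t^q)^{1/p}}<\infty$, and let $\sin_{p,q}:[0,\pi_{p,q}/2)\to[0,1)$ be the inverse function of $y\mapsto\int_0^y \frac{dt}{(1-t^q)^{1/p}}$, $y\in[0,1)$. The functions $\Phi,\Psi,\Phi^{-1}$ are real functions on $[0,1)$ given by the displayed formulas; $\Phi^{-1}$ denotes the inverse function of $\Phi$ there. *)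

(* Defs.v *)
From Stdlib Require Import Reals ClassicalEpsilon.
From Coquelicot Require Import Coquelicot.
Open Scope R_scope.

(* Real power of a nonnegative base with a positive exponent.  [Rpower]
   alone is not suitable at the base 0, since [Rpower 0 a = 1] in Stdlib. *)
Definition rpow (x a : R) : R :=
  if Req_EM_T x 0 then 0 else Rpower x a.

Definition integrand_pq (p q t : R) : R := 1 / rpow (1 - rpow t q) (1 / p).

Definition arcsin_pq (p q y : R) : R := RInt (integrand_pq p q) 0 y.

(* The integrand is singular at 1: the integral over [0,1) is improper. *)
Definition pi_pq (p q : R) : R :=
  2 * RInt_gen (integrand_pq p q) (at_point 0) (at_left 1).

(* The inverse function of [arcsin_pq p q] restricted to [0,1); its value is
   meaningful for p, q > 1 and 0 <= x < pi_pq p q / 2, where the [y] below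
   exists and is unique. *)
Definition sin_pq (p q x : R) : R :=
  epsilon (inhabits 0) (fun y => 0 <= y < 1 /\ arcsin_pq p q y = x).

Definition Phi (x : R) : R :=
  sqrt (1 - ((2 - 2 * x ^ 2 + 2 * sqrt (1 - x ^ 3)) /
             (2 + x ^ 2 + 2 * sqrt (1 - x ^ 3))) ^ 3).

Definition Psi (x : R) : R :=
  (4 * x * sqrt (1 - x ^ 3) * (3 + sqrt (1 - x ^ 3)) ^ 3) /
  ((1 + sqrt (1 - x ^ 3)) * (8 + x ^ 3) ^ 2).

Definition Phi_inv (x : R) : R :=
  (6 * x - 2 * (1 - rpow (1 - x ^ 2) (1 / 3)) ^ 2) /
  (2 + rpow (1 - x ^ 2) (1 / 3)) ^ 2.

(* Main.v *)
(* On the elliptic curve a^3 = 1 - b^2, the differential da/b is the one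
   inverted by sin_{2,3}, while c = (1 - t^2)^(1/3) turns dt/(1 - t^2)^(2/3)
   into -(3/2) dc/t on c^3 = 1 - t^2, the same curve.  Up to this factor 3/2,
   the arc length of sin_{3/2,2} is therefore the complementary arc length of
   sin_{2,3}, and the addition formula for the half period is the involution
   P |-> T - P, T = (0,1) + (1,0), written (a, b) |-> (tX a b, tY a b) below.
   Phi is its second coordinate and Phi_inv its first one, which makes them
   mutually inverse.  Psi is the duplication formula with origin (0,1); pulling
   the integrand back along it multiplies the integrand by 2, as long as the
   second coordinate dblY of the double is positive.  At the point s0 where
   dblY vanishes Psi reaches 1, so 2 * larc s0 bounds all arc lengths:
   s0 corresponds to the quarter period. *)
Require Import Defs.
From Stdlib Require Import Reals Ranalysis5 ClassicalEpsilon Lra.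
From Coquelicot Require Import Coquelicot.
Open Scope R_scope.

(** * Involution and duplication on the curve a^3 = 1 - b^2 *)

Definition tX (a b : R) : R := (2 - 2 * a ^ 2 + 2 * b) / (2 + a ^ 2 + 2 * b).

Definition tY (a b : R) : R :=
  3 * a * (1 + b) * (3 + b) / (2 + a ^ 2 + 2 * b) ^ 2.

Definition dblX (a b : R) : R :=
  4 * a * b * (3 + b) / ((1 + b) * (3 - b) ^ 2).

Definition dblY (b : R) : R :=
  (b ^ 4 + 24 * b ^ 3 + 18 * b ^ 2 - 27) / ((1 + b) * (3 - b) ^ 3).

Lemma tden_pos (a b : R) : -1 < b -> 0 < 2 + a ^ 2 + 2 * b.
Proof. intros; nra. Qed.

Lemma t_curve (a b : R) :
  -1 < b -> a ^ 3 = 1 - b ^ 2 -> tX a b ^ 3 = 1 - tY a b ^ 2.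
Proof.
  intros hb h. assert (hd := tden_pos a b hb).
  (* Rewriting a^3 by [h] reduces the identity to the coordinate ring of the curve. *)
  unfold tX, tY. field [h]; lra.
Qed.

Lemma t_involutive (a b : R) :
  -1 < b -> -1 < tY a b -> a ^ 3 = 1 - b ^ 2 ->
  tX (tX a b) (tY a b) = a /\ tY (tX a b) (tY a b) = b.
Proof.
  intros hb hY h.
  assert (hd := tden_pos a b hb). assert (hD := tden_pos (tX a b) _ hY).
  split.
  (* With the outer denominator cleared, [field] only has the inner one to discharge; [hD] takes
     care of the outer one. *)
  - assert (H : 2 - 2 * tX a b ^ 2 + 2 * tY a b
                = a * (2 + tX a b ^ 2 + 2 * tY a b)).
    { unfold tX, tY. field [h]; lra. }
    unfold tX at 1. rewrite H. field; lra.
  - assert (H : 3 * tX a b * (1 + tY a b) * (3 + tY a b)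
                = b * (2 + tX a b ^ 2 + 2 * tY a b) ^ 2).
    { unfold tX, tY. field [h]; lra. }
    unfold tY at 1. rewrite H. field; lra.
Qed.

Lemma dbl_curve (a b : R) :
  -1 < b < 3 -> a ^ 3 = 1 - b ^ 2 -> dblX a b ^ 3 = 1 - dblY b ^ 2.
Proof. intros hb h. unfold dblX, dblY. field [h]; lra. Qed.

Lemma tX_range (a b : R) : 0 < a <= 1 -> 0 <= b -> 0 <= tX a b < 1.
Proof.
  intros ha hb. assert (hd := tden_pos a b ltac:(lra)). unfold tX. split.
  - apply Rcomplements.Rdiv_le_0_compat; nra.
  - apply Rlt_div_l; nra.
Qed.

(** The upper bound comes from the curve: [tX a b] is positive, so the square of [tY a b] is below
    1. *)
Lemma tY_range (a b : R) :
  0 <= a < 1 -> 0 < b -> a ^ 3 = 1 - b ^ 2 -> 0 <= tY a b < 1.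
Proof.
  intros ha hb h. assert (hd := tden_pos a b ltac:(lra)).
  assert (hc := t_curve a b ltac:(lra) h).
  assert (hX : 0 < tX a b) by (apply Rdiv_lt_0_compat; nra).
  assert (0 < tX a b ^ 3) by (apply pow_lt; lra).
  assert (hY : 0 <= tY a b).
  { apply Rcomplements.Rdiv_le_0_compat; [|apply pow_lt; lra].
    assert (0 <= 3 * a * (1 + b)) by nra. nra. }
  nra.
Qed.

(** * The branch b >= 0 of the curve *)

Definition ucoord (s : R) : R := sqrt (1 - s ^ 3).

Lemma pow3_lt1 (s : R) : s < 1 -> s ^ 3 < 1.
Proof. intros; assert (0 < 1 + s + s ^ 2) by nra; nra. Qed.

Lemma ucoord_sqr (s : R) : s <= 1 -> s ^ 3 = 1 - ucoord s ^ 2.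
Proof.
  intros hs. unfold ucoord. rewrite pow2_sqrt; [lra|].
  assert (0 <= 1 + s + s ^ 2) by nra. nra.
Qed.

Lemma ucoord_pos (s : R) : s < 1 -> 0 < ucoord s.
Proof. intros hs. apply sqrt_lt_R0. assert (h := pow3_lt1 s hs). lra. Qed.

Lemma ucoord_le1 (s : R) : 0 <= s -> ucoord s <= 1.
Proof.
  intros hs. rewrite <- sqrt_1. apply sqrt_le_1_alt.
  assert (0 <= s ^ 3) by (apply pow_le; lra). lra.
Qed.

Lemma ucoord_0 : ucoord 0 = 1.
Proof. unfold ucoord. replace (1 - 0 ^ 3) with 1 by ring. apply sqrt_1. Qed.

Lemma ucoord_decr (s t : R) : 0 <= s <= t -> ucoord t <= ucoord s.
Proof.
  intros hs. apply sqrt_le_1_alt. assert (s ^ 3 <= t ^ 3) by (apply pow_incr; lra). lra.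
Qed.

Lemma is_derive_ucoord (s : R) :
  s < 1 -> is_derive ucoord s (- (3 / 2) * s ^ 2 / ucoord s).
Proof.
  intros hs. assert (h := pow3_lt1 s hs). assert (hu := ucoord_pos s hs).
  unfold ucoord in *. auto_derive; [lra|].
  replace (1 + - (s * (s * (s * 1)))) with (1 - s ^ 3) by ring. field. lra.
Qed.

(* Eta-expanded, as in the goals left by [auto_derive]. *)
Lemma Derive_ucoord (s : R) :
  s < 1 -> Derive (fun x : R => ucoord x) s = - (3 / 2) * s ^ 2 / ucoord s.
Proof. intros hs. now apply is_derive_unique, is_derive_ucoord. Qed.

Lemma continuous_ucoord (s : R) : continuous ucoord s.
Proof.
  apply (continuous_comp (fun s => 1 - s ^ 3) sqrt); [|apply continuous_sqrt].
  apply (ex_derive_continuous (V := R_NormedModule)). auto_derive. trivial.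
Qed.

(** * Real powers and cube roots *)

Lemma rpow_pos (x a : R) : 0 < x -> rpow x a = Rpower x a.
Proof. intros hx. unfold rpow. destruct (Req_EM_T x 0); lra. Qed.

Lemma rpow_cube (c : R) : 0 < c -> rpow (c ^ 3) (1 / 3) = c.
Proof.
  intros hc. assert (0 < c ^ 3) by (apply pow_lt; lra).
  rewrite rpow_pos; auto. rewrite <- (Rpower_pow 3 c hc), Rpower_mult.
  replace (INR 3 * (1 / 3)) with 1 by (simpl; field). now apply Rpower_1.
Qed.

Lemma cbrt_spec (z : R) :
  0 < z <= 1 -> 0 < rpow z (1 / 3) <= 1 /\ rpow z (1 / 3) ^ 3 = z.
Proof.
  intros hz. rewrite rpow_pos by lra.
  assert (hc : 0 < Rpower z (1 / 3)) by apply exp_pos.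
  assert (h3 : Rpower z (1 / 3) ^ 3 = z).
  { rewrite <- Rpower_pow, Rpower_mult; auto.
    replace (1 / 3 * INR 3) with 1 by (simpl; field). apply Rpower_1; lra. }
  repeat split; auto.
  destruct (Rle_lt_dec (Rpower z (1 / 3)) 1) as [|h1]; auto.
  assert (1 < Rpower z (1 / 3) ^ 3) by (apply Rlt_pow_R1; [lra|auto with arith]). lra.
Qed.

(** * [Phi] and [Phi_inv] as coordinates of the involution *)

(** The quotient cubed in [Phi] is [tX], so on the curve the radicand is the square of the
    nonnegative [tY]. *)
Lemma Phi_tY (s : R) : 0 <= s < 1 -> Phi s = tY s (ucoord s).
Proof.
  intros hs. assert (hu := ucoord_pos s ltac:(lra)).
  assert (h := ucoord_sqr s ltac:(lra)).
  assert (hr := tY_range s (ucoord s) hs hu h).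
  assert (hc := t_curve s (ucoord s) ltac:(lra) h).
  change (sqrt (1 - tX s (ucoord s) ^ 3) = tY s (ucoord s)).
  rewrite hc. replace (1 - (1 - tY s (ucoord s) ^ 2)) with (tY s (ucoord s) ^ 2) by ring.
  apply sqrt_pow2; lra.
Qed.

Lemma Phi_inv_tX (y : R) :
  0 <= y < 1 -> Phi_inv y = tX (rpow (1 - y ^ 2) (1 / 3)) y.
Proof.
  intros hy. unfold Phi_inv.
  destruct (cbrt_spec (1 - y ^ 2)) as [hc h]; [nra|].
  set (c := rpow (1 - y ^ 2) (1 / 3)) in *.
  unfold tX. assert (hd := tden_pos c y ltac:(lra)). field [h]; lra.
Qed.

Lemma Phi_range (s : R) : 0 <= s < 1 -> 0 <= Phi s < 1.
Proof.
  intros hs. rewrite Phi_tY by auto.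
  apply tY_range; [auto|apply ucoord_pos|apply ucoord_sqr]; lra.
Qed.

Lemma Phi_inv_range (y : R) : 0 <= y < 1 -> 0 <= Phi_inv y < 1.
Proof.
  intros hy. rewrite Phi_inv_tX by auto.
  apply tX_range; [apply cbrt_spec; nra|lra].
Qed.

(** Identifies the cube root inside [Phi_inv (Phi s)] as the first coordinate of T - P. *)
Lemma cbrt_Phi (s : R) :
  0 <= s < 1 -> 0 < tX s (ucoord s) /\ tX s (ucoord s) ^ 3 = 1 - Phi s ^ 2.
Proof.
  intros hs. assert (hu := ucoord_pos s ltac:(lra)). rewrite Phi_tY by auto. split.
  - apply Rdiv_lt_0_compat; nra.
  - apply t_curve; [lra|apply ucoord_sqr; lra].
Qed.

Lemma Phi_invK (s : R) : 0 <= s < 1 -> Phi_inv (Phi s) = s.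
Proof.
  intros hs. assert (hr := Phi_range s hs).
  destruct (cbrt_Phi s hs) as [hX hc].
  rewrite Phi_inv_tX, <- hc, rpow_cube by auto.
  rewrite Phi_tY in * by auto. assert (hu := ucoord_pos s ltac:(lra)).
  apply t_involutive; [lra|lra|apply ucoord_sqr; lra].
Qed.

Lemma PhiK (y : R) : 0 <= y < 1 -> Phi (Phi_inv y) = y.
Proof.
  intros hy. assert (hr := Phi_inv_range y hy).
  rewrite Phi_tY by auto. rewrite Phi_inv_tX in * by auto.
  destruct (cbrt_spec (1 - y ^ 2)) as [hc h]; [nra|].
  set (c := rpow (1 - y ^ 2) (1 / 3)) in *.
  assert (hd := tden_pos c y ltac:(lra)).
  assert (hY : 0 <= tY c y).
  { apply Rcomplements.Rdiv_le_0_compat; [|apply pow_lt; lra].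
    assert (0 <= 3 * c * (1 + y)) by nra. nra. }
  (* The image point lies on the branch b >= 0, so its first coordinate determines it. *)
  assert (hu : ucoord (tX c y) = tY c y).
  { unfold ucoord. rewrite t_curve by lra.
    replace (1 - (1 - tY c y ^ 2)) with (tY c y ^ 2) by ring.
    apply sqrt_pow2; lra. }
  rewrite hu. apply t_involutive; lra.
Qed.

(** * The integrand, its arc length and [sin_pq] *)

(** Even extension of the integrand to (-1, 1); it is smooth at 0 and so gives [arc] a two-sided
    derivative there. *)
Definition weight (t : R) : R := Rpower (1 - t ^ 2) (- (2 / 3)).

Lemma weight_cube (c t : R) : 0 < c -> c ^ 3 = 1 - t ^ 2 -> weight t = / c ^ 2.
Proof.
  intros hc h. unfold weight. rewrite <- h, <- (Rpower_pow 3 c hc), Rpower_mult.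
  replace (INR 3 * - (2 / 3)) with (- INR 2) by (simpl; field).
  now rewrite Rpower_Ropp, Rpower_pow.
Qed.

Lemma integrand_weight (t : R) : 0 < t < 1 -> integrand_pq (3 / 2) 2 t = weight t.
Proof.
  intros ht. unfold integrand_pq, weight.
  rewrite (rpow_pos t) by lra.
  replace (Rpower t 2) with (t ^ 2) by (rewrite <- Rpower_pow by lra; f_equal; simpl; lra).
  rewrite rpow_pos by nra.
  rewrite Rpower_Ropp. replace (1 / (3 / 2)) with (2 / 3) by field.
  unfold Rdiv at 1. ring.
Qed.

Lemma continuous_weight (t : R) : -1 < t < 1 -> continuous weight t.
Proof.
  intros ht. apply (ex_derive_continuous (V := R_NormedModule)).
  unfold weight, Rpower. auto_derive. nra.
Qed.

Lemma weight_pos (t : R) : 0 < weight t.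
Proof. apply exp_pos. Qed.

Lemma ex_RInt_weight (y : R) : -1 < y < 1 -> ex_RInt weight 0 y.
Proof.
  intros hy. apply (ex_RInt_continuous (V := R_CompleteNormedModule)).
  intros z hz. apply continuous_weight.
  destruct (Rle_dec 0 y).
  - rewrite Rmin_left, Rmax_right in hz; lra.
  - rewrite Rmin_right, Rmax_left in hz; lra.
Qed.

Definition arc (y : R) : R := RInt weight 0 y.

Lemma arc_0 : arc 0 = 0.
Proof. apply (RInt_point (V := R_CompleteNormedModule)). Qed.

Lemma arcsin_arc (y : R) : 0 <= y < 1 -> arcsin_pq (3 / 2) 2 y = arc y.
Proof.
  intros hy. apply (RInt_ext (V := R_CompleteNormedModule)). intros t ht.
  rewrite Rmin_left, Rmax_right in ht by lra. apply integrand_weight; lra.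
Qed.

Lemma is_derive_arc (y : R) : -1 < y < 1 -> is_derive arc y (weight y).
Proof.
  intros hy. apply (is_derive_RInt (V := R_CompleteNormedModule) weight arc 0).
  - assert (he : 0 < Rmin (y + 1) (1 - y)) by (apply Rmin_pos; lra).
    exists (mkposreal _ he). intros z hz.
    apply (RInt_correct (V := R_CompleteNormedModule)), ex_RInt_weight.
    assert (hz' : Rabs (z - y) < Rmin (y + 1) (1 - y)) by exact hz.
    assert (h1 := Rmin_l (y + 1) (1 - y)). assert (h2 := Rmin_r (y + 1) (1 - y)).
    apply Rabs_def2 in hz'. lra.
  - now apply continuous_weight.
Qed.

Lemma derive_continuity_pt (f : R -> R) (x d : R) : is_derive f x d -> continuity_pt f x.
Proof.
  intros h. apply continuity_pt_filterlim.
  apply (ex_derive_continuous (V := R_NormedModule)). now exists d.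
Qed.

Lemma arc_incr (y z : R) : 0 <= y < z -> z < 1 -> arc y < arc z.
Proof.
  intros hy hz.
  destruct (MVT_gen arc y z weight) as (c & _ & hc).
  - intros t ht. rewrite Rmin_left, Rmax_right in ht by lra. apply is_derive_arc; lra.
  - intros t ht. rewrite Rmin_left, Rmax_right in ht by lra.
    apply (derive_continuity_pt _ _ _ (is_derive_arc t ltac:(lra))).
  - assert (hw := weight_pos c). nra.
Qed.

(** Strict monotonicity of [arc] leaves [epsilon] a single choice, so exhibiting a point with the
    right arc length computes [sin_pq]. *)
Lemma sin_pq_unique (x y : R) :
  0 <= y < 1 -> arc y = x -> sin_pq (3 / 2) 2 x = y.
Proof.
  intros hy hx. unfold sin_pq.
  assert (hs := epsilon_spec (inhabits 0)
    (fun y => 0 <= y < 1 /\ arcsin_pq (3 / 2) 2 y = x)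
    (ex_intro _ y (conj hy (eq_trans (arcsin_arc y hy) hx)))).
  simpl in hs. revert hs. generalize (epsilon (inhabits 0)
    (fun y => 0 <= y < 1 /\ arcsin_pq (3 / 2) 2 y = x)).
  intros z [hz hzx]. rewrite arcsin_arc in hzx by auto.
  destruct (Rtotal_order z y) as [h|[h|h]]; auto.
  - assert (h' := arc_incr z y ltac:(lra) ltac:(lra)). lra.
  - assert (h' := arc_incr y z ltac:(lra) ltac:(lra)). lra.
Qed.

(** * Arc length in the coordinate s = [Phi_inv y] *)

Definition larc (s : R) : R := arc (tY s (ucoord s)).

Lemma larc_Phi (s : R) : 0 <= s < 1 -> larc s = arc (Phi s).
Proof. intros hs. unfold larc. now rewrite Phi_tY. Qed.

(** The derivative of [tY] carries the factor [tX] squared, which [weight] at [tY] cancels. Behind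
    this, P |-> T - P preserves da/b up to sign. *)
Lemma is_derive_larc (s : R) :
  0 <= s < 1 -> is_derive larc s (3 / 2 / ucoord s).
Proof.
  intros hs. assert (hu := ucoord_pos s ltac:(lra)).
  assert (h := ucoord_sqr s ltac:(lra)).
  assert (hd := tden_pos s (ucoord s) ltac:(lra)).
  assert (hr := tY_range s _ hs hu h).
  destruct (cbrt_Phi s hs) as [hX hc]. rewrite Phi_tY in hc by auto.
  assert (hdu := is_derive_ucoord s ltac:(lra)).
  assert (hdY : is_derive (fun s => tY s (ucoord s)) s
                  (3 / 2 / ucoord s * tX s (ucoord s) ^ 2)).
  { unfold tY. auto_derive.
    - repeat split; [now exists (- (3 / 2) * s ^ 2 / ucoord s)..|].
      simpl in *; nra.
    - rewrite Derive_ucoord by lra.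
      unfold tX. field [h]. simpl in hd; lra. }
  assert (hda : is_derive arc (tY s (ucoord s)) (weight (tY s (ucoord s))))
    by (apply is_derive_arc; lra).
  assert (hcomp := is_derive_comp arc _ s _ _ hda hdY).
  rewrite (weight_cube _ _ hX hc) in hcomp.
  replace (3 / 2 / ucoord s) with
    (scal (3 / 2 / ucoord s * tX s (ucoord s) ^ 2) (/ tX s (ucoord s) ^ 2)); [exact hcomp|].
  change (3 / 2 / ucoord s * tX s (ucoord s) ^ 2 * / tX s (ucoord s) ^ 2 = 3 / 2 / ucoord s).
  field. lra.
Qed.

Lemma larc_0 : larc 0 = 0.
Proof.
  unfold larc. replace (tY 0 (ucoord 0)) with 0; [apply arc_0|].
  rewrite ucoord_0. unfold tY. field.
Qed.

Lemma larc_incr (s t : R) : 0 <= s <= t -> t < 1 -> larc s <= larc t.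
Proof.
  intros hs ht.
  destruct (MVT_gen larc s t (fun z => 3 / 2 / ucoord z)) as (c & hc & he).
  - intros z hz. rewrite Rmin_left, Rmax_right in hz by lra. apply is_derive_larc; lra.
  - intros z hz. rewrite Rmin_left, Rmax_right in hz by lra.
    apply (derive_continuity_pt _ _ _ (is_derive_larc z ltac:(lra))).
  - rewrite Rmin_left, Rmax_right in hc by lra.
    assert (h : 0 < 3 / 2 / ucoord c) by (apply Rdiv_lt_0_compat; [lra|apply ucoord_pos; lra]).
    nra.
Qed.

(** * Duplication doubles the arc length *)

(** The numerator of [dblY], which carries its sign for b in [0, 1]. *)
Definition dblN (b : R) : R := b ^ 4 + 24 * b ^ 3 + 18 * b ^ 2 - 27.

Lemma dblN_incr (b c : R) : 0 <= b <= c -> dblN b <= dblN c.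
Proof.
  intros h. unfold dblN.
  assert (h2 := pow_incr b c 2 h). assert (h3 := pow_incr b c 3 h).
  assert (h4 := pow_incr b c 4 h). lra.
Qed.

Lemma dblY_pos (b : R) : 0 <= b <= 1 -> 0 < dblN b -> 0 < dblY b.
Proof.
  intros hb h. apply Rdiv_lt_0_compat; [exact h|].
  apply Rmult_lt_0_compat; [lra|apply pow_lt; lra].
Qed.

Lemma dblX_nonneg (a b : R) : 0 <= a -> 0 <= b <= 1 -> 0 <= dblX a b.
Proof.
  intros ha hb. apply Rcomplements.Rdiv_le_0_compat.
  - assert (0 <= 4 * a * b) by nra. nra.
  - apply Rmult_lt_0_compat; [lra|apply pow_lt; lra].
Qed.

Lemma dblX_range (a b : R) :
  0 <= a -> 0 <= b <= 1 -> a ^ 3 = 1 - b ^ 2 -> 0 < dblN b -> 0 <= dblX a b < 1.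
Proof.
  intros ha hb h hN. assert (hY := dblY_pos b hb hN).
  assert (hc := dbl_curve a b ltac:(lra) h).
  split; [now apply dblX_nonneg|].
  destruct (Rlt_le_dec (dblX a b) 1) as [|h1]; auto.
  assert (1 <= dblX a b ^ 3) by now apply pow_R1_Rle. nra.
Qed.

(** Duplication multiplies the invariant differential da/b by 2. *)
Lemma is_derive_dblX (s : R) :
  0 <= s < 1 ->
  is_derive (fun s => dblX s (ucoord s)) s (2 * dblY (ucoord s) / ucoord s).
Proof.
  intros hs. assert (hu := ucoord_pos s ltac:(lra)).
  assert (hu1 := ucoord_le1 s ltac:(lra)).
  assert (h := ucoord_sqr s ltac:(lra)).
  assert (hdu := is_derive_ucoord s ltac:(lra)).
  unfold dblX. auto_derive.
  - repeat split; [now exists (- (3 / 2) * s ^ 2 / ucoord s)..|].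
    apply Rgt_not_eq, Rmult_lt_0_compat; [lra|].
    apply Rmult_lt_0_compat; [lra|]. apply Rmult_lt_0_compat; lra.
  - rewrite Derive_ucoord by lra.
    unfold dblY. field [h]. lra.
Qed.

Lemma larc_dbl (s : R) :
  0 <= s < 1 -> 0 < dblN (ucoord s) -> larc (dblX s (ucoord s)) = 2 * larc s.
Proof.
  intros hs hN.
  assert (hd : forall t, 0 <= t <= s ->
    is_derive (fun t => larc (dblX t (ucoord t)) - 2 * larc t) t 0).
  { intros t ht.
    assert (hu := ucoord_pos t ltac:(lra)). assert (hu1 := ucoord_le1 t ltac:(lra)).
    assert (h := ucoord_sqr t ltac:(lra)).
    assert (hus := ucoord_pos s ltac:(lra)).
    (* Positivity of [dblN] passes from s to every smaller t, because [ucoord] decreases. *)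
    assert (hNt := dblN_incr _ _ (conj (Rlt_le _ _ hus) (ucoord_decr t s ltac:(lra)))).
    assert (hX := dblX_range t (ucoord t) ltac:(lra) ltac:(lra) h ltac:(lra)).
    assert (hY := dblY_pos (ucoord t) ltac:(lra) ltac:(lra)).
    (* The sign of [dblY] matters here: [ucoord] always returns the nonnegative root. *)
    assert (hXu : ucoord (dblX t (ucoord t)) = dblY (ucoord t)).
    { unfold ucoord at 1. rewrite dbl_curve by lra.
      replace (1 - (1 - dblY (ucoord t) ^ 2)) with (dblY (ucoord t) ^ 2) by ring.
      apply sqrt_pow2; lra. }
    assert (h1 := is_derive_comp larc _ t _ _ (is_derive_larc _ hX)
                    (is_derive_dblX t ltac:(lra))).
    assert (h2 := is_derive_scal larc t 2 _ (is_derive_larc t ltac:(lra))).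
    assert (h3 := is_derive_minus _ _ _ _ _ h1 h2). rewrite hXu in h3.
    replace 0 with (minus (scal (2 * dblY (ucoord t) / ucoord t)
      (3 / 2 / dblY (ucoord t))) (2 * (3 / 2 / ucoord t))); [exact h3|].
    unfold minus, plus, opp, scal; simpl; unfold mult; simpl. field. lra. }
  destruct (MVT_gen (fun t => larc (dblX t (ucoord t)) - 2 * larc t) 0 s (fun _ => 0))
    as (c & _ & he).
  - intros t ht. rewrite Rmin_left, Rmax_right in ht by lra. apply hd; lra.
  - intros t ht. rewrite Rmin_left, Rmax_right in ht by lra.
    apply (derive_continuity_pt _ _ _ (hd t ltac:(lra))).
  - simpl in he. replace (dblX 0 (ucoord 0)) with 0 in he.
    + rewrite larc_0 in he. lra.
    + rewrite ucoord_0. unfold dblX. field.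
Qed.

(** * The quarter period as a bound for all arc lengths *)

Lemma dblN_root : exists s0, 0 <= s0 < 1 /\ dblN (ucoord s0) = 0.
Proof.
  assert (h1 : ucoord 1 = 0).
  { unfold ucoord. replace (1 - 1 ^ 3) with 0 by ring. apply sqrt_0. }
  (* Negated so that the values rise from -16 at 0 to 27 at 1. *)
  destruct (IVT_interv (fun s => - dblN (ucoord s)) 0 1) as (s0 & hs & h0).
  - intros s _. apply continuity_pt_filterlim.
    apply (continuous_comp ucoord (fun b => - dblN b)); [apply continuous_ucoord|].
    apply (ex_derive_continuous (V := R_NormedModule)). unfold dblN. auto_derive. trivial.
  - lra.
  - rewrite ucoord_0. unfold dblN. lra.
  - rewrite h1. unfold dblN. lra.
  - exists s0. split; [split; [lra|]|lra].
    destruct (Rle_lt_or_eq_dec s0 1) as [|e]; [lra|auto|].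
    subst s0. rewrite h1 in h0. unfold dblN in h0. lra.
Qed.

(* The doubling map sends [0, s0] onto [0, 1], so every value of [arc] is twice a value of [larc] on [0, s0]. *)
Lemma arc_le_larc_root (s0 y : R) :
  0 <= s0 < 1 -> dblN (ucoord s0) = 0 -> 0 <= y < 1 -> arc y <= 2 * larc s0.
Proof.
  intros hs h0 hy. assert (ht := Phi_inv_range y hy).
  assert (hX1 : forall s, 0 <= s < 1 -> dblN (ucoord s) = 0 -> dblX s (ucoord s) = 1).
  { intros s h hN. assert (hu := ucoord_pos s ltac:(lra)).
    assert (hu1 := ucoord_le1 s ltac:(lra)).
    assert (hc := dbl_curve s (ucoord s) ltac:(lra) (ucoord_sqr s ltac:(lra))).
    assert (hX := dblX_nonneg s (ucoord s) ltac:(lra) ltac:(lra)).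
    unfold dblY in hc. fold (dblN (ucoord s)) in hc. rewrite hN in hc.
    unfold Rdiv in hc. rewrite Rmult_0_l in hc.
    (* With [dblY] zero the curve gives X^3 = 1, and the quadratic factor of X^3 - 1 has no real
       root. *)
    assert (hf : (dblX s (ucoord s) - 1) *
                 (dblX s (ucoord s) ^ 2 + dblX s (ucoord s) + 1) = 0) by lra.
    apply Rmult_integral in hf. destruct hf; nra. }
  assert (hs0 : 0 < s0).
  { destruct (Rle_lt_or_eq_dec 0 s0) as [|e]; [lra|auto|].
    subst s0. rewrite ucoord_0 in h0. unfold dblN in h0. lra. }
  destruct (f_interv_is_interv (fun s => dblX s (ucoord s)) 0 s0 (Phi_inv y))
    as (s & hs' & he).
  - exact hs0.
  - rewrite (hX1 s0 hs h0), ucoord_0.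
    replace (dblX 0 1) with 0 by (unfold dblX; field). lra.
  - intros s h. apply (derive_continuity_pt _ _ _ (is_derive_dblX s ltac:(lra))).
  - assert (hu0 := ucoord_pos s0 ltac:(lra)).
    assert (hN := dblN_incr _ _ (conj (Rlt_le _ _ hu0) (ucoord_decr s s0 hs'))).
    (* At a zero of [dblN] the double would be 1, but it equals [Phi_inv y], which is below 1. *)
    assert (hN' : 0 < dblN (ucoord s)).
    { destruct (Rle_lt_or_eq_dec 0 (dblN (ucoord s))) as [|e]; [lra|auto|].
      symmetry in e. apply hX1 in e; lra. }
    assert (hd := larc_dbl s ltac:(lra) hN'). simpl in he.
    rewrite he, larc_Phi, PhiK in hd by auto.
    assert (hi := larc_incr s s0 hs' ltac:(lra)). lra.
Qed.

(** * The improper integral defining [pi_pq] *)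

Lemma is_RInt_integrand (y : R) :
  0 <= y < 1 -> is_RInt (integrand_pq (3 / 2) 2) 0 y (arc y).
Proof.
  intros hy. apply (is_RInt_ext weight).
  - intros t ht. rewrite Rmin_left, Rmax_right in ht by lra.
    symmetry. apply integrand_weight; lra.
  - apply (RInt_correct (V := R_CompleteNormedModule)), ex_RInt_weight; lra.
Qed.

(** The integrand is positive on (0, 1), so its proper integrals increase to their supremum; this
    gives both convergence and the value. *)
Lemma pi_pq_lub (L : R) :
  is_lub (fun z => exists y, 0 <= y < 1 /\ z = arc y) L -> pi_pq (3 / 2) 2 = 2 * L.
Proof.
  intros [hub hleast]. unfold pi_pq. f_equal.
  apply (is_RInt_gen_unique (V := R_CompleteNormedModule)).
  intros P [eps hP].
  assert (hy0 : exists y0, 0 <= y0 < 1 /\ L - eps < arc y0).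
  { apply NNPP. intros hn. assert (he := cond_pos eps).
    assert (L <= L - eps); [|lra].
    apply hleast. intros z (y & hy & ->).
    apply Rnot_lt_le. intros hlt. apply hn. now exists y. }
  destruct hy0 as (y0 & hy0 & hlt).
  exists (eq 0) (fun y => y0 < y < 1).
  - reflexivity.
  - assert (he : 0 < 1 - y0) by lra. exists (mkposreal _ he). intros y hb hy.
    assert (hb' : Rabs (y - 1) < 1 - y0) by exact hb.
    apply Rabs_def2 in hb'. lra.
  - intros x y <- hy. exists (arc y). simpl. split.
    + apply is_RInt_integrand; lra.
    + apply hP. change (Rabs (arc y - L) < eps).
      assert (h1 := arc_incr y0 y ltac:(lra) ltac:(lra)).
      assert (h2 : arc y <= L) by (apply hub; exists y; split; [lra|auto]).
      assert (he := cond_pos eps). apply Rabs_def1; lra.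
Qed.

(** * [Psi] as duplication, and the double-angle formula *)

(** On the curve 8 + s^3 = 9 - u^2 with u = [ucoord s], so the factor (3 + u)^2 cancels. *)
Lemma Psi_dblX (s : R) : 0 <= s < 1 -> Psi s = dblX s (ucoord s).
Proof.
  intros hs. assert (hu := ucoord_pos s ltac:(lra)).
  assert (hu1 := ucoord_le1 s ltac:(lra)). assert (h := ucoord_sqr s ltac:(lra)).
  unfold Psi. fold (ucoord s).
  replace (8 + s ^ 3) with ((3 - ucoord s) * (3 + ucoord s)) by (rewrite h; ring).
  unfold dblX. field. lra.
Qed.

Theorem theorem3p13 :
  (forall x : R, 0 <= x < 1 ->
     0 <= Phi x < 1 /\ 0 <= Phi_inv x < 1 /\
     Phi_inv (Phi x) = x /\ Phi (Phi_inv x) = x) /\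
  (forall x : R, 0 <= x < pi_pq (3 / 2) 2 / 4 ->
     sin_pq (3 / 2) 2 (2 * x) = Phi (Psi (Phi_inv (sin_pq (3 / 2) 2 x)))).
Proof.
  split.
  { intros x hx. repeat split;
      try apply (Phi_range x hx); try apply (Phi_inv_range x hx);
      [now apply Phi_invK|now apply PhiK]. }
  intros x [hx0 hx]. destruct dblN_root as (s0 & hs0 & hN0).
  (* L is the half period [pi_pq (3 / 2) 2 / 2], so the hypothesis on x becomes x < L / 2. *)
  destruct (completeness (fun z => exists y, 0 <= y < 1 /\ z = arc y)) as [L hL].
  { exists (2 * larc s0). intros z (y & hy & ->). now apply arc_le_larc_root. }
  { exists (arc 0). exists 0. split; [lra|auto]. }
  rewrite (pi_pq_lub L hL) in hx. destruct hL as [_ hleast].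
  assert (hy : exists y, 0 <= y < 1 /\ arc y = x).
  { assert (hz : exists z, 0 <= z < 1 /\ x < arc z).
    { apply NNPP. intros hn. assert (L <= x); [|lra].
      apply hleast. intros w (y & hy & ->).
      apply Rnot_lt_le. intros hlt. apply hn. now exists y. }
    destruct hz as (z & hz & hxz).
    assert (hz0 : 0 < z).
    { destruct (Rle_lt_or_eq_dec 0 z) as [|e]; [lra|auto|].
      subst z. rewrite arc_0 in hxz. lra. }
    destruct (f_interv_is_interv arc 0 z x) as (y & hy & he).
    - exact hz0.
    - rewrite arc_0. lra.
    - intros t ht. apply (derive_continuity_pt _ _ _ (is_derive_arc t ltac:(lra))).
    - exists y. split; [lra|auto]. }
  destruct hy as (y & hy & he). rewrite (sin_pq_unique x y hy he).
  assert (hs := Phi_inv_range y hy).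
  assert (hl : larc (Phi_inv y) = x) by (rewrite larc_Phi, PhiK; auto).
  set (s := Phi_inv y) in *.
  assert (hu := ucoord_pos s ltac:(lra)). assert (hu1 := ucoord_le1 s ltac:(lra)).
  (* Otherwise s is a root of [dblN] or s0 <= s; either way 2 * x = 2 * [larc s] bounds all arc
     lengths, against x < L / 2. *)
  assert (hN : 0 < dblN (ucoord s)).
  { apply Rnot_le_lt. intros hle.
    assert (hss : s0 <= s).
    { apply Rnot_lt_le. intros hlt.
      assert (hu0 := ucoord_pos s0 ltac:(lra)).
      assert (hd := dblN_incr _ _ (conj (Rlt_le _ _ hu0) (ucoord_decr s s0 ltac:(lra)))).
      (* Left of s0 [dblN] is nonnegative, so s is itself a root and can replace s0 in the bound. *)
      assert (h0 : dblN (ucoord s) = 0) by lra.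
      assert (L <= 2 * x); [|lra].
      apply hleast. intros w (t & ht & ->). rewrite <- hl. now apply arc_le_larc_root. }
    assert (hi := larc_incr s0 s ltac:(lra) ltac:(lra)).
    assert (L <= 2 * x); [|lra].
    apply hleast. intros w (t & ht & ->).
    assert (hb := arc_le_larc_root s0 t hs0 hN0 ht). lra. }
  assert (hX := dblX_range s (ucoord s) ltac:(lra) ltac:(lra)
                  (ucoord_sqr s ltac:(lra)) hN).
  rewrite Psi_dblX by auto.
  apply sin_pq_unique; [now apply Phi_range|].
  rewrite <- larc_Phi by auto. rewrite larc_dbl by auto. lra.
Qed.
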